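(* Let $\Omega=\Omega_1\times\cdots\times\Omega_p\subset\mathbb{R}^p$ be a Cartesian product of compact intervals. Let $\phi$ be a probability density function on $\Omega$ which is continuous on $\Omega$ and satisfies $\phi(\mathbf x)>0$ for all $\mathbf x\in\Omega$. Let $f:\Omega\to\mathbb{R}$ be bounded on $\Omega$, and let $u$ be a subset of $\{1,\dots,p\}$. Let $V$ be the Banach space of all bounded functions on $\Omega$ equipped with the norm $\|\psi\|_V=\|\psi/\phi\|_{L^\infty(\Omega)}$, and define $F,G,T_u:V\to\mathbb{R}$ by $$F(\eta)=\frac12\int_{\Omega\times\Omega_u}(f(\mathbf x)-f(\mathbf x'))^2\,\eta(\mathbf x)\,\eta(\mathbf x')\,\frac{1}{\int_{\Omega_u}\eta(\mathbf x)\,d\mathbf x_u}\,d\mathbf x\,d\mathbf x_u',$$ $$G(\eta)=\int_\Omega f(\mathbf x)^2\eta(\mathbf x)\,d\mathbf x-\frac{1}{\int_\Omega\eta(\mathbf x)\,d\mathbf x}\left(\int_\Omega f(\mathbf x)\eta(\mathbf x)\,d\mathbf x\right)^2,$$ $$T_u(\eta)=\frac{F(\eta)}{G(\eta)}.$$ Then the operator $T_u$ is Fréchet differentiable at $\phi$ with Fréchet derivative $\mathscr{D}T_u(\phi):V\to\mathbb{R}$ given by the bounded linear operator $$\mathscr{D}T_u(\phi)\psi=\frac{\mathscr{D}F(\phi)\psi}{G(\phi)}-T_u(\phi)\,\frac{\mathscr{D}G(\phi)\psi}{G(\phi)},$$ where \begin{align*} \mathscr{D}F(\phi)\psi=&\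 \frac12\int_{\Omega\times\Omega_u}(f(\mathbf x)-f(\mathbf x'))^2\,\frac{\psi(\mathbf x')}{\phi(\mathbf x')}\,\phi(\mathbf x)\,\phi_{\mathbf x\vert\mathbf x_{\sim u}}(\mathbf x'\vert\mathbf x_{\sim u})\,d\mathbf x\,d\mathbf x_u'\\ &+\frac12\int_{\Omega\times\Omega_u}(f(\mathbf x)-f(\mathbf x'))^2\,\frac{\psi(\mathbf x)}{\phi(\mathbf x)}\,\phi(\mathbf x)\,\phi_{\mathbf x\vert\mathbf x_{\sim u}}(\mathbf x'\vert\mathbf x_{\sim u})\,d\mathbf x\,d\mathbf x_u'\\ &-\frac12\int_{\Omega\times\Omega_u}(f(\mathbf x)-f(\mathbf x'))^2\,\frac{\int_{\Omega_u}\psi(\mathbf x)\,d\mathbf x_u}{\int_{\Omega_u}\phi(\mathbf x)\,d\mathbf x_u}\,\phi(\mathbf x)\,\phi_{\mathbf x\vert\mathbf x_{\sim u}}(\mathbf x'\vert\mathbf x_{\sim u})\,d\mathbf x\,d\mathbf x_u' \end{align*} and \begin{align*} \mathscr{D}G(\phi)\psi=&\ \int_\Omega f(\mathbf x)^2\,\frac{\psi(\mathbf x)}{\phi(\mathbf x)}\,\phi(\mathbf x)\,d\mathbf x-2\int_\Omega f(\mathbf x)\phi(\mathbf x)\,d\mathbf x\int_\Omega f(\mathbf x)\,\frac{\psi(\mathbf x)}{\phi(\mathbf x)}\,\phi(\mathbf x)\,d\mathbf x\\ &+\left(\int_\Omega\frac{\psi(\mathbf x)}{\phi(\mathbf x)}\,\phi(\mathbf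 x)\,d\mathbf x\right)\left(\int_\Omega f(\mathbf x)\phi(\mathbf x)\,d\mathbf x\right)^2 . \end{align*}
   Context: Notation. For $u\subset\{1,\dots,p\}$, $\sim u=\{1,\dots,p\}\setminus u$ is its complement and $\Omega_u$ is the Cartesian product of the $\Omega_k$, $k\in u$. A point $\mathbf x\in\Omega$ is partitioned as $\mathbf x=(\mathbf x_u,\mathbf x_{\sim u})$, where $\mathbf x_u$ collects the coordinates with index in $u$ and $\mathbf x_{\sim u}$ the remaining ones (a partitioning of the entries of $\mathbf x$, not a permutation). In integrals over $\Omega\times\Omega_u$ the variable is $(\mathbf x,\mathbf x_u')$ with $\mathbf x\in\Omega$, $\mathbf x_u'\in\Omega_u$, and $\mathbf x'=(\mathbf x_u',\mathbf x_{\sim u})$, so $\mathbf x'$ shares the $\sim u$ coordinates of $\mathbf x$. For a function $\eta$ on $\Omega$, $\int_{\Omega_u}\eta(\mathbf x)\,d\mathbf x_u$ is the function of $\mathbf x_{\sim u}$ obtained by integrating out the $u$ coordinates. $\phi$ is the density of a random vector $\mathbf X=(X_1,\dots,X_p)$ of input variables with values in $\Omega$, and $\phi_{\mathbf x\vert\mathbf x_{\sim u}}(\mathbf x'\vert\mathbf x_{\sim u})=\phi(\mathbf x')\big/\int_{\Omega_u}\phi(\mathbf x)\,d\mathbf x_u$ is the conditional density of $\mathbf X\vert\mathbf X_{\sim u}$. $\|\cdot\|_{L^\infty(\Omega)}$ is the supremum norm on the set of bounded functions on $\Omega$. Every $\eta\in V$ with $\|\phi-\eta\|_V\le1$ is nonnegative,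 and $T_u(\eta)$ is then the total Sobol' index of $f$ for the variables $\mathbf X_u$ computed with respect to the density $\eta/\int_\Omega\eta(\mathbf x)\,d\mathbf x$. In particular $T_u(\phi)=1-\operatorname{Var}(\mathbb{E}[f(\mathbf X)\vert\mathbf X_{\sim u}])/\operatorname{Var}(f(\mathbf X))$ and $G(\phi)=\operatorname{Var}(f(\mathbf X))$. Remark: the theorem does not list non-constancy of $f$ among its hypotheses, but its proof takes $G(\eta)>0$ in a neighborhood of $\phi$, ''assuming $f(\mathbf x)$ is non constant''.
   Formalization: The function f and the elements of V are taken to be bounded Borel measurable functions on Ω rather than arbitrary bounded functions, since the integrals defining F, G and T_u are undefined for non-measurable functions. *)

(* Defs.v *)
From HB Require Import structures.
From mathcomp Require Import all_boot all_order all_algebra.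
From mathcomp Require Import all_classical all_reals all_analysis.
From mathcomp Require Import measurable_realfun.

Set Implicit Arguments.
Unset Strict Implicit.
Unset Printing Implicit Defensive.
Import Order.TTheory GRing.Theory Num.Theory.
Import numFieldNormedType.Exports.

Local Open Scope classical_set_scope.
Local Open Scope ring_scope.

(* R^n is 'rV[R]_n with the product sigma-algebra, i.e. the Borel one: see
   open_measurable_rV. *)
Section rV_measurable.
Context {R : realType} (n : nat).

Let coord : 'I_n -> 'rV[R]_n -> measurableTypeR R := fun i x => x ord0 i.

Let rV_set0 : g_sigma_preimage coord set0.
Proof. exact: sigma_algebra0. Qed.

Let rV_setC A : g_sigma_preimage coord A -> g_sigma_preimage coord (~` A).
Proof. exact: sigma_algebraC. Qed.

Let rV_bigcup (F : _^nat) : (forall i, g_sigma_preimage coord (F i)) ->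
  g_sigma_preimage coord (\bigcup_i (F i)).
Proof. exact: sigma_algebra_bigcup. Qed.

HB.instance Definition _ := @isMeasurable.Build default_measure_display
  'rV[R]_n (g_sigma_preimage coord) rV_set0 rV_setC rV_bigcup.

Lemma measurable_coord (i : 'I_n) :
  measurable_fun [set: 'rV[R]_n] (fun x : 'rV[R]_n => x ord0 i).
Proof.
move=> _ Y mY; rewrite setTI; apply: sub_sigma_algebra => /=.
rewrite -bigcup_seq/=; exists i => /=; first by rewrite mem_index_enum.
by exists Y => //; rewrite setTI.
Qed.

Lemma measurable_fun_rVP d (T : measurableType d) (f : T -> 'rV[R]_n) :
  measurable_fun setT f <->
  forall i, measurable_fun setT (fun t => f t ord0 i).
Proof.
split=> [mf i|mf].
  by apply: (measurableT_comp (measurable_coord i) mf).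
apply: (@measurability _ _ _ _ setT f
  (\big[setU/set0]_(i < n) preimage_set_system setT (coord i) measurable)) => //.
move=> _ [B + <-]; rewrite -bigcup_seq => -[i _ [C mC <-]].
by rewrite setTI => /=; have := mf i measurableT _ mC; rewrite !setTI.
Qed.

End rV_measurable.

Section lebesgue_rV.
Context {R : realType}.

Section cons.
Variables (n : nat) (m : {sigma_finite_measure set 'rV[R]_n -> \bar R}).

Definition rV_cons (z : measurableTypeR R * 'rV[R]_n) : 'rV[R]_n.+1 :=
  row_mx (const_mx z.1 : 'rV[R]_1) z.2.

Lemma rV_cons0 z : rV_cons z ord0 ord0 = z.1.
Proof.
apply: etrans (etrans (@row_mxEl R 1 1 n (const_mx z.1) z.2 ord0 ord0) _).
  by congr (row_mx _ _ _ _); exact: val_inj.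
by rewrite mxE.
Qed.

Lemma rV_consS z i : rV_cons z ord0 (lift ord0 i) = z.2 ord0 i.
Proof.
rewrite -(@row_mxEr R 1 1 n (const_mx z.1) z.2).
by congr (row_mx _ _ _ _); exact: val_inj.
Qed.

Lemma measurable_rV_cons : measurable_fun setT rV_cons.
Proof.
apply/measurable_fun_rVP => i; case: (unliftP ord0 i) => [j ->|->].
  under eq_fun do rewrite rV_consS.
  exact: (measurableT_comp (measurable_coord j) measurable_snd).
under eq_fun do rewrite rV_cons0; exact: measurable_fst.
Qed.

HB.instance Definition _ := isMeasurableFun.Build _ _ _ _
  rV_cons measurable_rV_cons.

Definition lebesgue_cons := pushforward (lebesgue_measure \x m)%E rV_cons.

Let lebesgue_cons0 : lebesgue_cons set0 = 0%E.
Proof. exact: measure0. Qed.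

Let lebesgue_cons_ge0 A : (0 <= lebesgue_cons A)%E.
Proof. exact: measure_ge0. Qed.

Let lebesgue_cons_sigma_additive : semi_sigma_additive lebesgue_cons.
Proof. exact: measure_semi_sigma_additive. Qed.

HB.instance Definition _ := isMeasure.Build _ _ _ lebesgue_cons
  lebesgue_cons0 lebesgue_cons_ge0 lebesgue_cons_sigma_additive.

Let lebesgue_cons_sigma_finite : sigma_finite setT lebesgue_cons.
Proof.
have /sigma_finiteP[F [UF ndF Foo]] := sigma_finiteT (@lebesgue_measure R).
have /sigma_finiteP[G [UG ndG Goo]] := sigma_finiteT m.
pose g (x : 'rV[R]_n.+1) : measurableTypeR R * 'rV[R]_n :=
  (x ord0 ord0, \row_i x ord0 (lift ord0 i)).
have mg : measurable_fun setT g.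
  apply: measurable_fun_pair; first exact: measurable_coord.
  apply/measurable_fun_rVP => i; under eq_fun do rewrite mxE.
  exact: measurable_coord.
have gK z : g (rV_cons z) = z.
  rewrite /g rV_cons0 [RHS]surjective_pairing; congr pair.
  by apply/rowP => i; rewrite mxE rV_consS.
exists (fun k => g @^-1` (F k `*` G k)).
  apply/esym; rewrite -subTset => x _.
  have [i _ Fi] : (\bigcup_i F i) (g x).1 by rewrite -UF.
  have [j _ Gj] : (\bigcup_i G i) (g x).2 by rewrite -UG.
  exists (maxn i j) => //; split.
  - by move: Fi; exact/subsetPset/ndF/leq_maxl.
  - by move: Gj; exact/subsetPset/ndG/leq_maxr.
move=> k; have [mF Fk] := Foo k; have [mG Gk] := Goo k.
have mFG : measurable (F k `*` G k) by exact: measurableX.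
split; first by rewrite -[X in measurable X]setTI; exact: mg.
rewrite /lebesgue_cons /pushforward -comp_preimage.
rewrite (_ : g \o rV_cons = id); last exact/funext.
by rewrite preimage_id product_measure1E// lte_mul_pinfty// ge0_fin_numE.
Qed.

HB.instance Definition _ := Measure_isSigmaFinite.Build _ _ _
  lebesgue_cons lebesgue_cons_sigma_finite.

End cons.

(* Volume of a box: lebesgue_rV_box. *)
Fixpoint lebesgue_rV n : {sigma_finite_measure set 'rV[R]_n -> \bar R} :=
  if n is n'.+1 then lebesgue_cons (lebesgue_rV n') else \d_(0 : 'rV[R]_0).

End lebesgue_rV.

Section box.
Context {R : realType} {p : nat}.
Implicit Types a b x : 'rV[R]_p.

Definition box a b : set 'rV[R]_p :=
  [set x | forall i, a ord0 i <= x ord0 i <= b ord0 i].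

Lemma measurable_box a b : measurable (box a b).
Proof.
rewrite (_ : box a b = \big[setI/setT]_(i < p)
    ((fun x : 'rV[R]_p => x ord0 i) @^-1` `[a ord0 i, b ord0 i])).
  apply: bigsetI_measurable => i _; rewrite -[X in measurable X]setTI.
  exact: measurable_coord.
rewrite -bigcap_seq; apply/seteqP; split => [x abx i _|x abx i].
  by rewrite /= in_itv/=; exact: abx.
by have := abx i (mem_index_enum i); rewrite /= in_itv.
Qed.

Lemma compact_box a b : compact (box a b).
Proof.
rewrite (_ : box a b =
    [set x | forall i, (`[a ord0 i, b ord0 i]%classic) (x ord0 i)]).
  apply: (@rV_compact _ _ (fun i => `[a ord0 i, b ord0 i]%classic)) => i.
  exact: segment_compact.
by apply/seteqP; split => x abx i; have := abx i; rewrite /= in_itv.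
Qed.

Lemma open_measurable_rV (O : set 'rV[R]_p) : open O -> measurable O.
Proof.
move=> oO.
pose B (ck : 'rV[rat]_p * nat) : set 'rV[R]_p :=
  box (\row_i (ratr (ck.1 ord0 i) - ck.2.+1%:R^-1))
      (\row_i (ratr (ck.1 ord0 i) + ck.2.+1%:R^-1)).
rewrite (_ : O = \bigcup_(ck in [set ck | B ck `<=` O]) B ck); last first.
  apply/seteqP; split=> [x Ox|x [ck /= BO]]; last exact: BO.
  have /nbhs_ballP[e /= e0 xeO] := open_nbhs_nbhs (conj oO Ox).
  have [k _ /(_ _ (leqnn k))/= ke] :=
    near_infty_natSinv_lt (PosNum (divr_gt0 e0 (ltr0n R 2))).
  set d : R := k.+1%:R^-1 in ke.
  have d0 : 0 < d by rewrite invr_gt0.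
  have /choice[c xc] (i : 'I_p) : exists q : rat, `|x ord0 i - ratr q| < d.
    have [|q] := @rat_in_itvoo R (x ord0 i - d) (x ord0 i + d).
      by rewrite ltrBlDr -addrA ltrDl addr_gt0.
    by rewrite in_itv/= => /andP[xq qx]; exists q; rewrite distrC ltr_distl xq.
  exists (\row_i c i, k) => /=.
    apply: subset_trans xeO => y By; split => // j i; rewrite (ord1 j).
    move: (By i); rewrite !mxE -ler_distl => yc.
    rewrite -ball_normE /= (splitr e) (le_lt_trans (ler_distD (ratr (c i)) _ _))//.
    by rewrite ltrD// ?(lt_trans (xc i))// distrC (le_lt_trans yc).
  by move=> i; rewrite !mxE -ler_distl; exact/ltW/xc.
rewrite bigcup_mkcond; apply: countable_bigcupT_measurable => // ck.
by case: ifP => // _; exact: measurable_box.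
Qed.

Lemma within_continuous_measurable_rV (D : set 'rV[R]_p) (f : 'rV[R]_p -> R) :
  measurable D -> {within D, continuous f} -> measurable_fun D f.
Proof.
move=> mD /continuousP cf; apply: (measurability _ (RGenOpens.measurableE R)).
move=> _ [_ [a [b ->] <-]]; rewrite setIC.
have /cf/open_subspaceP[V oV VD] : open `]a, b[%classic by exact: interval_open.
by rewrite -VD; apply: measurableI => //; exact: open_measurable_rV.
Qed.

End box.

Lemma lebesgue_rV_box (R : realType) n (a b : 'rV[R]_n) :
  (forall i, a ord0 i <= b ord0 i) ->
  lebesgue_rV n (box a b) = (\prod_i (b ord0 i - a ord0 i))%:E.
Proof.
elim: n a b => [|n ih] a b ab.
  by rewrite big_ord0 /= diracE mem_set// => -[].
pose tl (c : 'rV[R]_n.+1) : 'rV[R]_n := \row_i c ord0 (lift ord0 i).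
rewrite /= /lebesgue_cons /pushforward.
rewrite (_ : _ @^-1` _ =
    `[a ord0 ord0, b ord0 ord0]%classic `*` box (tl a) (tl b)).
  rewrite product_measure1E//; last exact: measurable_box.
  rewrite ih; last by move=> i; rewrite !mxE.
  rewrite [X in (X * _)%E](_ : _ = (b ord0 ord0 - a ord0 ord0)%:E); last first.
    apply: etrans (lebesgue_measure_itv `[a ord0 ord0, b ord0 ord0]) _.
    rewrite /= lte_fin.
    have [//|ba] := ltP (a ord0 ord0) (b ord0 ord0).
    by rewrite (@le_anti _ _ (a ord0 ord0) (b ord0 ord0)) ?ab// subrr.
  rewrite -EFinM big_ord_recl; congr (_ * _)%:E.
  by apply: eq_bigr => i _; rewrite !mxE.
apply/seteqP; split => -[t y].
  move=> aby; split => [|i] /=.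
    by have := aby ord0; rewrite rV_cons0 in_itv.
  by have := aby (lift ord0 i); rewrite rV_consS !mxE.
move=> [/=]; rewrite in_itv/= => abt aby i.
case: (unliftP ord0 i) => [j ->|->]; rewrite ?rV_cons0 ?rV_consS//.
by have := aby j; rewrite !mxE.
Qed.

Section bmfun.
Context {R : realType} {p : nat} (a b : 'rV[R]_p).

(* Bounded functions on Omega = box a b are encoded by their extension by 0 to
   R^p, so that Leibniz equality is equality on Omega. They are taken Borel
   measurable, which all the integrals below presuppose. *)
Definition bmfun : {pred 'rV[R]_p -> R} := mem [set g : 'rV[R]_p -> R |
  [/\ measurable_fun setT g, [bounded g x | x in setT]
    & forall x, ~ box a b x -> g x = 0]].

Let bounded_funP (g : 'rV[R]_p -> R) :
  [bounded g x | x in setT] <-> exists M : R, forall x, `|g x| <= M.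
Proof.
have PF : ProperFilter (globally [set: 'rV[R]_p]).
  exact: (@globally_properfilter _ _ 0).
rewrite (@ex_bound _ R R g _ PF).
by split => -[M gM]; exists M => x; [exact: gM|move=> _; exact: gM].
Qed.

Lemma bmfun_submod_closed : submod_closed bmfun.
Proof.
split=> [|k g h]; rewrite ?inE /=.
  split => //; first exact: measurable_cst.
  by apply/bounded_funP; exists 0 => x /=; rewrite normr0.
move=> [mg bg g0] [mh bh h0]; split.
- by apply: measurable_funD => //; exact: measurable_funM.
- move/bounded_funP : bg => [M gM]; move/bounded_funP : bh => [N hN].
  apply/bounded_funP; exists (`|k| * M + N) => x /=.
  rewrite (le_trans (ler_normD _ _))// lerD//.
  by rewrite normrM ler_wpM2l.
- by move=> x abx; rewrite -[LHS]/(k * g x + h x) g0// h0// mulr0 addr0.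
Qed.

HB.instance Definition _ := GRing.isSubmodClosed.Build R _ bmfun
  bmfun_submod_closed.

Lemma bmfunP (g : 'rV[R]_p -> R) : g \in bmfun <->
  [/\ measurable_fun setT g, exists M : R, forall x, `|g x| <= M
    & forall x, ~ box a b x -> g x = 0].
Proof. by rewrite inE /=; split=> -[mg /bounded_funP bg g0]; split. Qed.

End bmfun.

Section wspace.
Context {R : realType} {p : nat} {a b : 'rV[R]_p} {phi : 'rV[R]_p -> R}.

(* The bounded functions on Omega with norm sup_Omega |psi / phi|. The weight
   and its properties are parameters of the type because the norm depends on
   phi. Norm: wnorm, completeness: wspace_complete. *)
Record wspace (phi_cont : {within box a b, continuous phi})
    (phi_gt0 : forall x, box a b x -> 0 < phi x) := WSpace {
  wspace_fun :> 'rV[R]_p -> R ;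
  _ : wspace_fun \in bmfun a b }.

Variable phi_cont : {within box a b, continuous phi}.
Variable phi_gt0 : forall x, box a b x -> 0 < phi x.

Local Notation V := (wspace phi_cont phi_gt0).
Local Notation Omega := (box a b).
Implicit Types psi : V.

HB.instance Definition _ := [isSub for @wspace_fun phi_cont phi_gt0].
HB.instance Definition _ := [Choice of V by <:].
HB.instance Definition _ := [SubChoice_isSubLmodule of V by <:].

Lemma wspaceP psi : [/\ measurable_fun setT (psi : 'rV[R]_p -> R),
  exists M : R, forall x, `|psi x| <= M & forall x, ~ Omega x -> psi x = 0].
Proof. by case: psi => psi psiB; exact/bmfunP. Qed.

Definition wnorm psi : R := sup [set `|psi x / phi x| | x in Omega].

Lemma phi_ge : exists2 c : R, 0 < c & forall x, Omega x -> c <= phi x.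
Proof.
have [E0|/set0P NE] := eqVneq Omega set0.
  by exists 1 => // x; rewrite E0.
have [c cO cphi] := compact_EVT_min NE (@compact_box _ _ a b) phi_cont.
exists (phi c); first by apply: phi_gt0; exact: set_mem.
by move=> x Ox; apply: cphi; exact: mem_set.
Qed.

Lemma phi_le : exists M : R, forall x, Omega x -> `|phi x| <= M.
Proof.
have [E0|/set0P NE] := eqVneq Omega set0.
  by exists 0 => // x; rewrite E0.
have [c cO cphi] := compact_EVT_max NE (@compact_box _ _ a b) phi_cont.
exists (phi c) => x Ox; rewrite gtr0_norm; last exact: phi_gt0.
by apply: cphi; exact: mem_set.
Qed.

Lemma wnorm_ub psi x : Omega x -> `|psi x / phi x| <= wnorm psi.
Proof.
move=> Ox; apply: ub_le_sup; last by exists x.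
have [_ [M psiM] _] := wspaceP psi; have [c c0 cphi] := phi_ge.
exists (M / c) => _ [y Oy <-]; rewrite normrM normfV (gtr0_norm (phi_gt0 Oy)).
apply: ler_pM => //; first by rewrite invr_ge0 ltW// phi_gt0.
by rewrite lef_pV2 ?posrE// ?cphi//; exact: phi_gt0.
Qed.

Lemma wnorm_le psi M : 0 <= M ->
  (forall x, Omega x -> `|psi x / phi x| <= M) -> wnorm psi <= M.
Proof.
move=> M0 psiM; have [E0|/set0P[x Ox]] := eqVneq Omega set0.
  by rewrite /wnorm E0 image_set0 sup0.
by apply: ge_sup; [exists `|psi x / phi x|, x|move=> _ [y Oy <-]; exact: psiM].
Qed.

Lemma wnorm_ge0 psi : 0 <= wnorm psi.
Proof.
have [E0|/set0P[x Ox]] := eqVneq Omega set0.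
  by rewrite /wnorm E0 image_set0 sup0.
by rewrite (le_trans _ (wnorm_ub psi Ox)).
Qed.

Let wnormD psi1 psi2 : wnorm (psi1 + psi2) <= wnorm psi1 + wnorm psi2.
Proof.
apply: wnorm_le => [|x Ox]; first by rewrite addr_ge0 ?wnorm_ge0.
rewrite -[(psi1 + psi2) x]/(psi1 x + psi2 x) mulrDl.
by rewrite (le_trans (ler_normD _ _))// lerD// wnorm_ub.
Qed.

Let wnormZ (k : R) psi : wnorm (k *: psi) = `|k| * wnorm psi.
Proof.
have wnormZ_le l (g : V) : wnorm (l *: g) <= `|l| * wnorm g.
  apply: wnorm_le => [|x Ox]; first by rewrite mulr_ge0 ?wnorm_ge0.
  by rewrite -[(l *: g) x]/(l * g x) -mulrA normrM ler_wpM2l// wnorm_ub.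
apply/eqP; rewrite eq_le wnormZ_le /=.
have [->|k0] := eqVneq k 0; first by rewrite normr0 mul0r wnorm_ge0.
rewrite -ler_pdivlMl ?normr_gt0// -normfV.
by rewrite (le_trans _ (wnormZ_le _ _))// scalerA mulVf// scale1r.
Qed.

Let wnorm0_eq0 psi : wnorm psi = 0 -> psi = 0.
Proof.
move=> psi0; apply/val_inj/funext => x /=; have [Ox|Ox] := pselect (Omega x).
  have := wnorm_ub psi Ox; rewrite psi0 normr_le0 mulf_eq0 invr_eq0.
  by rewrite (gt_eqF (phi_gt0 Ox)) orbF => /eqP.
by have [_ _ ->] := wspaceP psi.
Qed.

HB.instance Definition _ :=
  Lmodule_isNormed.Build R V wnormD wnormZ wnorm0_eq0.

Lemma wnormE psi : `|psi| = wnorm psi. Proof. by []. Qed.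

Lemma wspace_complete (F : set_system V) :
  ProperFilter F -> cauchy F -> cvg F.
Proof.
move=> FF /(@cauchyP _ _ F) Fc.
pose e n : R := n.+1%:R^-1.
have e0 n : 0 < e n by rewrite invr_gt0.
have /choice[g Fg] n : exists g, F (ball g (e n)) by exact: Fc.
have gd n m : `|g n - g m| < e n + e m.
  have [h [gnh gmh]] := filter_ex (filterI (Fg n) (Fg m)).
  rewrite (le_lt_trans (ler_distD h _ _))// ltrD//.
  by move: gmh; rewrite -ball_normE /= distrC.
have [M0 phiM0] := phi_le; pose M := `|M0| + 1.
have M_gt0 : 0 < M by rewrite ltr_wpDl.
have phiM x : Omega x -> phi x <= M.
  move=> Ox; rewrite (le_trans (ler_norm _))// (le_trans (phiM0 _ Ox))//.
  by rewrite (le_trans (ler_norm _))// lerDl.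
have gx n m x : Omega x -> `|g n x - g m x| <= (e n + e m) * phi x.
  move=> Ox; have px := phi_gt0 Ox.
  rewrite -ler_pdivrMr// -{1}(gtr0_norm px) -normfV -normrM.
  exact: le_trans (wnorm_ub (g n - g m) Ox) (ltW (gd n m)).
have gxM n m x : `|g n x - g m x| <= (e n + e m) * M.
  have [Ox|Ox] := pselect (Omega x).
    by rewrite (le_trans (gx _ _ _ Ox))// ler_pM2l ?addr_gt0// phiM.
  have [[_ _ ->//] [_ _ ->//]] := (wspaceP (g n), wspaceP (g m)).
  by rewrite subrr normr0 mulr_ge0 ?(ltW M_gt0)// addr_ge0// ltW.
have ecvg : e n @[n --> \oo] --> 0 by exact: cvg_harmonic.
have gcvg x : cvgn (fun n => g n x).
  apply: cauchy_cvg; apply: cauchy_exP => eps eps0.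
  have : \forall n \near \oo, e n < eps / 2 / M.
    by move/cvgrPdist_lt : ecvg => /(_ (eps / 2 / M)); 
      rewrite !divr_gt0// => /(_ isT); apply: filterS => n;
      rewrite sub0r normrN gtr0_norm.
  move=> [N _ Neps]; exists (g N x); exists N => // n /= Nn.
  rewrite -ball_normE /= (le_lt_trans (gxM _ _ _))// -ltr_pdivlMr//.
  by rewrite (splitr eps) mulrDl ltrD// Neps/=.
pose h x := limn (fun n => g n x).
have gh x : g n x @[n --> \oo] --> h x by exact: gcvg.
have gnh n x : Omega x -> `|g n x - h x| <= e n * phi x.
  move=> Ox.
  have : (e n + e m) * phi x + `|g m x - h x| @[m --> \oo] -->
      (e n + 0) * phi x + `|h x - h x|.
    apply: cvgD; last by apply: cvg_norm; apply: cvgB => //; exact: cvg_cst.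
    by apply: cvgMl; apply: cvgD => //; exact: cvg_cst.
  rewrite addr0 subrr normr0 addr0 => /cvgr_to_ge; apply.
  near=> m; rewrite (le_trans (ler_distD (g m x) _ _))// lerD2r; exact: gx.
have h0 x : ~ Omega x -> h x = 0.
  move=> Ox; apply/cvg_lim => //; rewrite (_ : (fun n => g n x) = cst 0).
    exact: cvg_cst.
  by apply/funext => n; have [_ _ ->] := wspaceP (g n).
have hB : h \in bmfun a b.
  apply/bmfunP; split => //.
    apply: (@measurable_fun_cvg _ _ _ setT (fun n => g n : _ -> R)) => [n|x _].
      by have [] := wspaceP (g n).
    exact: gh.
  have [_ [K gK] _] := wspaceP (g 0%N); exists (K + e 0%N * M) => x.
  have [Ox|Ox] := pselect (Omega x); last first.
    rewrite h0// normr0 addr_ge0//; last by rewrite mulr_ge0// ltW.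
    exact: le_trans (gK 0).
  rewrite -(subKr (g 0%N x) (h x)) (le_trans (ler_normB _ _))// lerD//.
  by rewrite (le_trans (gnh _ _ Ox))// ler_pM2l// phiM.
apply/cvg_ex; exists (WSpace phi_cont phi_gt0 hB); apply/cvgrPdist_lt => eps eps0.
have : \forall n \near \oo, e n < eps / 2.
  by move/cvgrPdist_lt : ecvg => /(_ (eps / 2)); 
    rewrite !divr_gt0// => /(_ isT); apply: filterS => n;
    rewrite sub0r normrN gtr0_norm.
move=> [N _ /(_ N (leqnn N))/= Neps].
apply: filterS (Fg N) => k; rewrite -ball_normE /= => gNk.
rewrite (le_lt_trans (ler_distD (g N) _ _))// (splitr eps) ltrD//; last first.
  exact: lt_trans Neps.
rewrite (le_lt_trans _ Neps)//; apply: wnorm_le => [|x Ox]; first exact: ltW.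
have px := phi_gt0 Ox.
rewrite normrM normfV (gtr0_norm px) ler_pdivrMr// distrC.
exact: gnh.
Unshelve. all: by end_near. Qed.

HB.instance Definition _ := Uniform_isComplete.Build V wspace_complete.

Lemma weight_bmfun : phi \_ Omega \in bmfun a b.
Proof.
apply/bmfunP; split => [||x Ox]; last by rewrite patchE memNset.
  apply/(measurable_restrictT _ (measurable_box a b)).
  by apply: within_continuous_measurable_rV => //; exact: measurable_box.
have [M phiM] := phi_le; exists (Num.max 0 M) => x; rewrite patchE.
case: ifPn => [/set_mem Ox|_]; rewrite le_max ?phiM ?orbT//.
by rewrite normr0 lexx.
Qed.

(* phi itself, as an element of V. *)
Definition weight : V := WSpace phi_cont phi_gt0 weight_bmfun.

End wspace.
Arguments weight {R p a b phi} phi_cont phi_gt0.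

Section partition.
Context {R : realType} {p : nat} (u : {set 'I_p}).

Definition subcoord (x : 'rV[R]_p) : 'rV[R]_#|u| :=
  \row_j x ord0 (enum_val j).

(* With x' = glue x y, x'_u is y (listed in increasing order of index) and x'
   agrees with x outside u: see glue_in and glue_notin. *)
Definition glue (x : 'rV[R]_p) (y : 'rV[R]_#|u|) : 'rV[R]_p :=
  \row_i (if [pick j : 'I_#|u| | enum_val j == i] is Some j
          then y ord0 j else x ord0 i).

Lemma glue_in x y (j : 'I_#|u|) : glue x y ord0 (enum_val j) = y ord0 j.
Proof.
rewrite mxE; case: pickP => [k /eqP/enum_val_inj->//|/(_ j)].
by rewrite eqxx.
Qed.

Lemma glue_notin x y i : i \notin u -> glue x y ord0 i = x ord0 i.
Proof.
move=> iu; rewrite mxE; case: pickP => // k /eqP ki.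
by move: iu; rewrite -ki enum_valP.
Qed.

Lemma glue_box (a b x : 'rV[R]_p) (y : 'rV[R]_#|u|) : box a b x ->
  box (subcoord a) (subcoord b) y -> box a b (glue x y).
Proof.
move=> abx aby i; have [iu|iu] := boolP (i \in u); last by rewrite glue_notin.
rewrite -(enum_rankK_in iu iu) glue_in.
by have := aby (enum_rank_in iu i); rewrite !mxE.
Qed.

End partition.

Section sobol.
Context {R : realType} {p : nat} (a b : 'rV[R]_p) (f : 'rV[R]_p -> R).
Variable u : {set 'I_p}.

Local Notation Omega := (box a b).
Local Notation Omega_u := (box (subcoord u a) (subcoord u b)).
Local Notation mu := (lebesgue_rV p).
Local Notation mu_u := (lebesgue_rV #|u|).
Implicit Types (eta phi psi : 'rV[R]_p -> R) (x : 'rV[R]_p).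

(* The integral of eta over Omega_u; it only depends on the coordinates of x
   outside u. *)
Definition marginal eta x : R := \int[mu_u]_(y in Omega_u) eta (glue x y).

(* The integral of h x x' over the pairs (x, x'_u) in Omega * Omega_u. *)
Definition dint (h : 'rV[R]_p -> 'rV[R]_p -> R) : R :=
  \int[(mu \x mu_u)%E]_(z in Omega `*` Omega_u) h z.1 (glue z.1 z.2).

Definition sobolF eta : R :=
  2^-1 * dint (fun x x' =>
    (f x - f x') ^+ 2 * eta x * eta x' * (1 / marginal eta x)).

Definition sobolG eta : R :=
  \int[mu]_(x in Omega) (f x ^+ 2 * eta x) -
  1 / (\int[mu]_(x in Omega) eta x) *
    (\int[mu]_(x in Omega) (f x * eta x)) ^+ 2.

Definition sobolT eta : R := sobolF eta / sobolG eta.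

Definition cond_density phi x' x : R := phi x' / marginal phi x.

Definition sobolDF phi psi : R :=
  2^-1 * dint (fun x x' => (f x - f x') ^+ 2 * (psi x' / phi x') *
    phi x * cond_density phi x' x)
  + 2^-1 * dint (fun x x' => (f x - f x') ^+ 2 * (psi x / phi x) *
    phi x * cond_density phi x' x)
  - 2^-1 * dint (fun x x' => (f x - f x') ^+ 2 *
    (marginal psi x / marginal phi x) * phi x * cond_density phi x' x).

Definition sobolDG phi psi : R :=
  \int[mu]_(x in Omega) (f x ^+ 2 * (psi x / phi x) * phi x)
  - 2 * (\int[mu]_(x in Omega) (f x * phi x)) *
      (\int[mu]_(x in Omega) (f x * (psi x / phi x) * phi x))
  + (\int[mu]_(x in Omega) (psi x / phi x * phi x)) *
      (\int[mu]_(x in Omega) (f x * phi x)) ^+ 2.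

Definition sobolDT phi psi : R :=
  sobolDF phi psi / sobolG phi - sobolT phi * (sobolDG phi psi / sobolG phi).

End sobol.

(* Main.v *)
From HB Require Import structures.
Require Import Defs.
From mathcomp Require Import all_boot all_order all_algebra.
From mathcomp Require Import all_classical all_reals all_analysis.
From mathcomp Require Import ring lra measurable_realfun.
Import Order.TTheory GRing.Theory Num.Theory.
Import numFieldNormedType.Exports.
Local Open Scope classical_set_scope.
Local Open Scope ring_scope.

(* With al = psi(x) / phi(x), be = psi(x') / phi(x'), ga the quotient of the
   marginals of psi and phi, and w = (f(x) - f(x'))^2 phi(x) phi(x') / marginal,
   F(phi + psi) = 1/2 int w (1 + al) (1 + be) / (1 + ga), where al, be and ga
   are linear in psi and bounded by the weighted norm of psi. Since
   (1 + al) (1 + be) / (1 + ga) - 1 - (al + be - ga)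
     = (al - ga) (be - ga) / (1 + ga),
   the linear part is DF(phi) psi and the remainder is quadratic in |psi|. The
   operator G is a rational expression in continuous linear functionals, and T
   is handled by the quotient rule when G(phi) <> 0. Otherwise f is a.e.
   constant, so G vanishes identically, hence so does T, as x / 0 = 0. *)

Set Implicit Arguments.
Unset Strict Implicit.
Unset Printing Implicit Defensive.

(** * Bounded measurable functions *)

Section bounded_measurable.
Context d (T : measurableType d) (R : realType).
Implicit Types (D : set T) (g h : T -> R).

(** On a set of finite measure this class is integrable, and it is stable under the ring operations,
    so integrability of each integrand below follows from its algebraic shape. *)
Definition bounded_measurable D g :=
  measurable_fun D g /\ exists M, forall x, D x -> `|g x| <= M.

Lemma bounded_measurable_cst D (k : R) : bounded_measurable D (fun=> k).
Proof. by split; [exact: measurable_cst|exists `|k|]. Qed.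

Lemma bounded_measurableD D g h : bounded_measurable D g ->
  bounded_measurable D h -> bounded_measurable D (fun x => g x + h x).
Proof.
move=> [mg [M gM]] [mh [N hN]]; split; first exact: measurable_funD.
by exists (M + N) => x Dx; rewrite (le_trans (ler_normD _ _))// lerD ?gM ?hN.
Qed.

Lemma bounded_measurableM D g h : bounded_measurable D g ->
  bounded_measurable D h -> bounded_measurable D (fun x => g x * h x).
Proof.
move=> [mg [M gM]] [mh [N hN]]; split; first exact: measurable_funM.
by exists (M * N) => x Dx; rewrite normrM ler_pM ?gM ?hN.
Qed.

Lemma bounded_measurableB D g h : bounded_measurable D g ->
  bounded_measurable D h -> bounded_measurable D (fun x => g x - h x).
Proof.
move=> [mg [M gM]] [mh [N hN]]; split; first exact: measurable_funB.
by exists (M + N) => x Dx; rewrite (le_trans (ler_normB _ _))// lerD ?gM ?hN.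
Qed.

Lemma bounded_measurableX D g n : bounded_measurable D g ->
  bounded_measurable D (fun x => g x ^+ n).
Proof.
move=> [mg [M gM]]; split; first exact: measurable_funX.
exists (M ^+ n) => x Dx.
by rewrite normrX lerXn2r ?nnegrE ?gM// (le_trans _ (gM _ Dx)).
Qed.

Lemma bounded_measurableV D g (c : R) : measurable D -> 0 < c ->
  (forall x, D x -> c <= g x) -> bounded_measurable D g ->
  bounded_measurable D (fun x => (g x)^-1).
Proof.
move=> mD c0 cg [mg _]; split; last first.
  exists c^-1 => x /cg cgx; have gx := lt_le_trans c0 cgx.
  by rewrite gtr0_norm ?invr_gt0// lef_pV2.
(* On positive values the inverse is the real power of exponent -1, a measurable function. *)
apply: (@eq_measurable_fun _ _ _ _ _ (fun x => g x `^ (-1))).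
  by move=> x /set_mem/cg cgx; rewrite powR_inv1// (le_trans (ltW c0)).
exact: (measurableT_comp (measurable_powR (-1)) mg).
Qed.

Lemma eq_bounded_measurable D g h : (forall x, D x -> g x = h x) ->
  bounded_measurable D g -> bounded_measurable D h.
Proof.
move=> gh [mg [M gM]]; split; last by exists M => x Dx; rewrite -gh// gM.
by apply: eq_measurable_fun mg => x /set_mem; exact: gh.
Qed.

Variable mu : {measure set T -> \bar R}.
Context D (mD : measurable D) (Doo : (mu D < +oo)%E).

Lemma bounded_measurable_integrable g :
  bounded_measurable D g -> mu.-integrable D (EFin \o g).
Proof.
move=> [mg [M gM]]; apply: measurable_bounded_integrable => //.
exists M; split; first exact: num_real.
by move=> N /ltW MN x Dx /=; rewrite (le_trans (gM _ Dx)).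
Qed.

Lemma bounded_measurable_normr_Rintegral g (M : R) : bounded_measurable D g ->
  (forall x, D x -> `|g x| <= M) ->
  `|\int[mu]_(x in D) g x| <= M * fine (mu D).
Proof.
move=> bg gM; have ig := bounded_measurable_integrable bg.
rewrite -Rintegral_cst// (le_trans (le_normr_Rintegral _ _))//.
apply: le_Rintegral => //; first exact: (integrable_norm ig).
by apply: bounded_measurable_integrable; exact: bounded_measurable_cst.
Qed.

End bounded_measurable.

Lemma bounded_measurable_comp d d' (T : measurableType d)
  (T' : measurableType d') (R : realType) (D : set T) (E : set T')
  (F : T' -> T) (g : T -> R) : measurable D -> (forall x, E x -> D (F x)) ->
  measurable_fun setT F -> bounded_measurable D g ->
  bounded_measurable E (g \o F).
Proof.
move=> mD DE mF [mg [M gM]]; split.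
  apply: (measurable_comp mD _ mg) => [_ [x Ex <-]|]; first exact: DE.
  exact: measurable_funTS.
by exists M => x Ex; apply: gM; exact: DE.
Qed.

(** * Differentiability from a quadratic remainder *)

Section quadratic_remainder.
Context (R : realType) (V : normedModType R).

(** The linear bound makes [L] continuous, and a remainder of order |v|^2 near 0 is o(|v|);
    uniqueness of the differential then identifies it with [L]. *)
Lemma is_diff_quadratic (F L : V -> R^o) (x : V) (K e : R) : linear L ->
  (forall v, `|L v| <= K * `|v|) -> 0 < e ->
  (forall v, `|v| <= e -> `|F (v + x) - F x - L v| <= K * `|v| ^+ 2) ->
  is_diff x F L.
Proof.
move=> linL LK e0 FL.
pose LM := GRing.isLinear.Build _ _ _ _ _ linL.
pose L' : {linear V -> R^o} := HB.pack L LM.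
have cL : continuous L'.
  apply: bounded_linear_continuous; apply/linear_boundedP.
  exists K; split; first exact: num_real.
  by move=> r /ltW Kr v; rewrite (le_trans (LK v))// ler_wpM2r.
have FE : F \o shift x = cst (F x) + L' +o_ 0 id.
  apply/eqaddoP => _/posnumP[eps].
  (* Within this radius K |v| <= eps; the + 1 guards against K = 0. *)
  have d0 : 0 < eps%:num / (`|K| + 1) by rewrite divr_gt0// ltr_wpDl.
  apply: filterS2 (nbhs0_le e0) (nbhs0_le d0) => v ve vd.
  rewrite [X in `|X|](_ : _ = F (v + x) - F x - L v); last first.
    by rewrite !fctE /= opprD addrA.
  rewrite (le_trans (FL v ve))// expr2 mulrA ler_wpM2r//.
  rewrite (@le_trans _ _ ((`|K| + 1) * `|v|))//.
    by rewrite ler_wpM2r// (le_trans (ler_norm K))// lerDl.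
  by rewrite mulrC -ler_pdivlMr// ltr_wpDl.
have dF : 'd F x = L' :> (V -> R^o) by exact: diff_unique.
by apply: DiffDef => //; apply/diff_locallyP; rewrite dF.
Qed.

Lemma is_diff_linear (L : V -> R^o) (x : V) (K : R) : linear L ->
  (forall v, `|L v| <= K * `|v|) -> is_diff x L L.
Proof.
move=> linL LK.
apply: (@is_diff_quadratic _ _ x `|K| 1) => // [v|v _].
  by rewrite (le_trans (LK v))// ler_wpM2r// ler_norm.
have -> : L (v + x) = L v + L x by rewrite -[v]scale1r linL !scale1r.
by rewrite addrK subrr normr0 mulr_ge0.
Qed.
End quadratic_remainder.

(** Common shape of the linear functionals below: a fixed weight [w] against a pointwise linear
    family [A v] controlled by |v|. The operator bound is a bound of [w] times [C] times the measure
    of [D]. *)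
Lemma Rintegral_linear_bounded d (T : measurableType d) (R : realType)
    (mu : {measure set T -> \bar R}) (D : set T) (V : normedModType R)
    (A : V -> T -> R) (w : T -> R) (C : R) :
  measurable D -> (mu D < +oo)%E -> bounded_measurable D w ->
  (forall v, measurable_fun D (A v)) ->
  (forall v x, D x -> `|A v x| <= C * `|v|) ->
  (forall k v1 v2 x, D x -> A (k *: v1 + v2) x = k * A v1 x + A v2 x) ->
  let L : V -> R^o := fun v => \int[mu]_(x in D) (w x * A v x) in
  linear L /\ exists K, forall v, `|L v| <= K * `|v|.
Proof.
move=> mD Doo bw mA AC Alin L.
have bA v : bounded_measurable D (A v).
  by split => //; exists (C * `|v|); exact: AC.
have bwA v := bounded_measurableM bw (bA v).
have iwA v := bounded_measurable_integrable mD Doo (bwA v).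
split=> [k v1 v2|].
  rewrite -[k *: L v1]/(k * L v1) /L -RintegralZl// -RintegralD//.
  - by apply: eq_Rintegral => x /set_mem Dx; rewrite Alin//; ring.
  - apply: (bounded_measurable_integrable mD Doo).
    by apply: bounded_measurableM => //; exact: bounded_measurable_cst.
have [mw [M wM]] := bw; exists (M * C * fine (mu D)) => v.
rewrite mulrAC -(mulrA M).
apply: bounded_measurable_normr_Rintegral => // x Dx.
by rewrite normrM ler_pM// ?wM ?AC.
Qed.

(** * Measurability of gluing and of marginals *)

Section glue_measurable.
Context (R : realType) (p : nat) (u : {set 'I_p}).

(** Each coordinate of the glued point is a coordinate of [z.2] or of [z.1], according to membership
    in [u]. *)
Lemma measurable_glue : measurable_fun setT
  (fun z : 'rV[R]_p * 'rV[R]_#|u| => Defs.glue z.1 z.2).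
Proof.
apply/measurable_fun_rVP => i.
have [iu|iu] := boolP (i \in u).
  rewrite (_ : (fun _ => _) =
      (fun y : 'rV[R]__ => y ord0 (enum_rank_in iu i)) \o snd).
    exact: measurableT_comp (measurable_coord _) measurable_snd.
  by apply/funext => z /=; rewrite -{1}(enum_rankK_in iu iu) glue_in.
rewrite (_ : (fun _ => _) = (fun x : 'rV[R]__ => x ord0 i) \o fst).
  exact: measurableT_comp (measurable_coord _) measurable_fst.
by apply/funext => z /=; rewrite glue_notin.
Qed.

(** The measurability part of Tonelli's theorem covers nonnegative integrands, so the marginal is
    split into the integrals of the positive and negative parts. *)
Lemma measurable_marginal (a b : 'rV[R]_p) (g : 'rV[R]_p -> R) :
  measurable_fun setT g -> measurable_fun setT (marginal a b u g).
Proof.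
move=> mg; pose E := box (subcoord u a) (subcoord u b).
pose h : 'rV[R]_p * 'rV[R]_#|u| -> \bar R :=
  (fun z => (g (Defs.glue z.1 z.2))%:E) \_ ([set: 'rV[R]_p] `*` E).
have mh : measurable_fun setT h.
  apply: (measurable_restrictT _ _).1.
    by apply: measurableX => //; exact: measurable_box.
  apply: measurable_funTS; apply/measurable_EFinP.
  exact: (measurableT_comp mg measurable_glue).
have mF : measurable_fun setT
    (fun x => fubini_F (lebesgue_rV #|u|) h^\+ x -
              fubini_F (lebesgue_rV #|u|) h^\- x)%E.
  apply: emeasurable_funB; apply: measurable_fun_fubini_tonelli_F => //.
    exact: measurable_funepos.
  exact: measurable_funeneg.
rewrite (_ : marginal a b u g = fine \o
    (fun x => fubini_F (lebesgue_rV #|u|) h^\+ x -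
              fubini_F (lebesgue_rV #|u|) h^\- x)%E).
  exact: (measurableT_comp (fine_measurable measurableT) mF).
apply/funext => x; rewrite /marginal /Rintegral /=; congr fine.
rewrite integral_mkcond [LHS]integralE /fubini_F.
have hE y : ((fun y => (g (Defs.glue x y))%:E) \_ E) y = h (x, y).
  rewrite /h !patchE; congr (if _ then _ else _).
  by apply/idP/idP => /set_mem H; apply/mem_set => //; case: H.
by congr (_ - _)%E; apply: eq_integral => y _; rewrite ?funeposE ?funenegE hE.
Qed.

End glue_measurable.

(** * Volumes of boxes and estimates of marginals *)

Section finite_boxes.

Context (R : realType) (p : nat) (a b : 'rV[R]_p).
Hypothesis ab : forall i, a ord0 i <= b ord0 i.

Lemma subcoord_le (u : {set 'I_p}) j :
  subcoord u a ord0 j <= subcoord u b ord0 j.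
Proof. by rewrite !mxE ab. Qed.

Lemma lebesgue_rV_box_lty : (lebesgue_rV p (box a b) < +oo)%E.
Proof. by rewrite lebesgue_rV_box// ltry. Qed.

End finite_boxes.

Section marginal.
Context (R : realType) (p : nat) (a b : 'rV[R]_p) (u : {set 'I_p}).
Hypothesis ab : forall i, a ord0 i <= b ord0 i.
Local Notation Omega := (box a b).
Local Notation Omega_u := (box (subcoord u a) (subcoord u b)).
Local Notation mu := (lebesgue_rV p).
Local Notation mu_u := (lebesgue_rV #|u|).
Implicit Types (g h : 'rV[R]_p -> R) (x : 'rV[R]_p).

Let Omega_u_lty : (mu_u Omega_u < +oo)%E.
Proof. exact/lebesgue_rV_box_lty/subcoord_le. Qed.

Let mOmega_u : measurable Omega_u. Proof. exact: measurable_box. Qed.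

Lemma bounded_measurable_glue g x : bounded_measurable Omega g -> Omega x ->
  bounded_measurable Omega_u (fun y => g (Defs.glue x y)).
Proof.
move=> bg Ox; apply: (bounded_measurable_comp (measurable_box a b) _ _ bg).
  by move=> y; exact: glue_box.
exact: (measurableT_comp (@measurable_glue R p u) (measurable_pair1 x)).
Qed.

Lemma marginalD k g h x : bounded_measurable Omega g ->
  bounded_measurable Omega h -> Omega x ->
  marginal a b u (fun x => k * g x + h x) x =
  k * marginal a b u g x + marginal a b u h x.
Proof.
move=> bg bh Ox; rewrite /marginal RintegralD ?RintegralZl//.
- by apply: bounded_measurable_integrable => //; exact: bounded_measurable_glue.
- apply: bounded_measurable_integrable => //; apply: bounded_measurableM.
    exact: bounded_measurable_cst.
  exact: bounded_measurable_glue.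
- by apply: bounded_measurable_integrable => //; exact: bounded_measurable_glue.
Qed.

Lemma le_marginal g h x : bounded_measurable Omega g ->
  bounded_measurable Omega h -> (forall x, Omega x -> `|g x| <= h x) ->
  Omega x -> `|marginal a b u g x| <= marginal a b u h x.
Proof.
move=> bg bh gh Ox.
have ig := bounded_measurable_integrable mOmega_u Omega_u_lty
  (bounded_measurable_glue bg Ox).
rewrite (le_trans (le_normr_Rintegral _ _))//; apply: le_Rintegral => //.
- exact: (integrable_norm ig).
- by apply: bounded_measurable_integrable => //; exact: bounded_measurable_glue.
- by move=> y Oy; rewrite gh//; exact: glue_box.
Qed.

Lemma eq_marginal g h x : (forall x, Omega x -> g x = h x) -> Omega x ->
  marginal a b u g x = marginal a b u h x.
Proof.
move=> gh Ox; apply: eq_Rintegral => y /set_mem Oy.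
by rewrite gh//; exact: glue_box.
Qed.

Lemma bounded_measurable_marginal g : bounded_measurable Omega g ->
  bounded_measurable Omega (marginal a b u g).
Proof.
move=> bg.
(* [g] is measurable on [Omega] only; its extension by 0 is measurable everywhere and has the same
   marginal over points of [Omega], since gluing stays in the box. *)
apply: (@eq_bounded_measurable _ _ _ _ (marginal a b u (g \_ Omega))).
  by move=> x Ox; apply: eq_marginal => // {Ox}x Ox; rewrite patchE mem_set.
have [mg [M gM]] := bg; split.
  apply: measurable_funTS; apply: measurable_marginal.
  by apply: (measurable_restrictT _ _).1 => //; exact: measurable_box.
exists (M * fine (mu_u Omega_u)) => x Ox.
apply: (bounded_measurable_normr_Rintegral mOmega_u Omega_u_lty).
  apply: bounded_measurable_glue => //; apply: eq_bounded_measurable bg.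
  by move=> {Ox}x Ox; rewrite patchE mem_set.
by move=> y Oy; rewrite patchE mem_set ?gM//; exact: glue_box.
Qed.

Lemma marginal_cst (c : R) x :
  marginal a b u (fun=> c) x = c * fine (mu_u Omega_u).
Proof. exact: Rintegral_cst. Qed.

(** Volumes are products of side lengths: if the full product is nonzero, no side degenerates and
    the subproduct over [u] is positive. *)
Lemma subbox_gt0 : mu Omega != 0%E -> 0 < fine (mu_u Omega_u).
Proof.
rewrite lebesgue_rV_box// lebesgue_rV_box; last exact: subcoord_le.
rewrite eqe /= => /prodf_neq0 ab0; apply: prodr_gt0 => j _.
by rewrite !mxE subr_gt0 lt_neqAle ab andbT eq_sym -subr_eq0 ab0.
Qed.

Lemma dint_box_lty : ((mu \x mu_u) (Omega `*` Omega_u) < +oo)%E.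
Proof.
rewrite product_measure1E//; last exact: measurable_box.
change (mu Omega * mu_u Omega_u < +oo)%E.
rewrite (lebesgue_rV_box ab) (lebesgue_rV_box (subcoord_le ab (u := u))).
by rewrite -EFinM ltry.
Qed.

End marginal.

(** * Differentials of integral functionals and of G *)

Section sobol_differential.
Context (R : realType) (p : nat) (a b : 'rV[R]_p).
Hypothesis ab : forall i, a ord0 i <= b ord0 i.
Context (phi : 'rV[R]_p -> R).
Hypothesis phi_cont : {within box a b, continuous phi}.
Hypothesis phi_gt0 : forall x, box a b x -> 0 < phi x.
Hypothesis phi_pdf : \int[lebesgue_rV p]_(x in box a b) phi x = 1.
Context (f : 'rV[R]_p -> R).
Hypothesis bf : bounded_measurable (box a b) f.
Local Notation Omega := (box a b).
Local Notation mu := (lebesgue_rV p).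
Local Notation V := (wspace phi_cont phi_gt0).
Local Notation phiV := (weight phi_cont phi_gt0).

Let mOmega : measurable Omega. Proof. exact: measurable_box. Qed.

Let Omega_lty : (mu Omega < +oo)%E. Proof. exact: lebesgue_rV_box_lty. Qed.

Let bV (psi : V) : bounded_measurable Omega (psi : 'rV[R]_p -> R).
Proof.
have [mpsi [M psiM] _] := wspaceP psi; split; last by exists M.
exact: measurable_funTS.
Qed.

(** [phiV] is the extension of [phi] by 0, so the two may differ off [Omega]. *)
Let phiVE x : Omega x -> phiV x = phi x.
Proof. by move=> Ox; rewrite /= patchE mem_set. Qed.

Let bphi : bounded_measurable Omega phi.
Proof. exact: eq_bounded_measurable phiVE (bV phiV). Qed.

Let bphiV : bounded_measurable Omega (fun x => (phi x)^-1).
Proof.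
have [c c0 cphi] := phi_ge phi_cont phi_gt0.
exact: bounded_measurableV c0 cphi bphi.
Qed.

(** The factor 1 is the constant [C] of [Rintegral_linear_bounded]. *)
Let ratio_le (psi : V) x : Omega x -> `|psi x / phi x| <= 1 * `|psi|.
Proof. by move=> Ox; rewrite mul1r wnormE; exact: wnorm_ub. Qed.

Let ratioD k (psi1 psi2 : V) x :
  (k *: psi1 + psi2) x / phi x = k * (psi1 x / phi x) + psi2 x / phi x.
Proof.
by rewrite -[(k *: psi1 + psi2) x]/(k * psi1 x + psi2 x) mulrDl mulrA.
Qed.

Let wspace_le (psi : V) x : Omega x -> `|psi x| <= `|psi| * phi x.
Proof.
move=> Ox; have px := phi_gt0 Ox.
rewrite -ler_pdivrMr// -{1}(gtr0_norm px) -normfV -normrM -[leRHS]mul1r.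
exact: ratio_le.
Qed.

(** A null box could not carry a density of integral 1. With [subbox_gt0] this makes the volume of
    [Omega_u] positive. *)
Lemma box_measure_neq0 : mu Omega != 0%E.
Proof.
apply/eqP => mu0; have [M phiM] := phi_le phi_cont phi_gt0.
have := bounded_measurable_normr_Rintegral mOmega Omega_lty bphi phiM.
rewrite phi_pdf (_ : fine _ = 0); last by apply: (congr1 fine mu0).
by rewrite mulr0 normr1 ler10.
Qed.

(** The functional is linear, hence its own differential; it is rewritten with the quotient psi /
    phi because the weighted norm controls that quotient. *)
Lemma is_diff_Rintegral (h : 'rV[R]_p -> R) : bounded_measurable Omega h ->
  is_diff phiV (fun eta : V => \int[mu]_(x in Omega) (h x * eta x) : R^o)
    (fun psi : V =>
       \int[mu]_(x in Omega) (h x * (psi x / phi x) * phi x) : R^o).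
Proof.
move=> bh; have E (psi : V) :
    \int[mu]_(x in Omega) (h x * (psi x / phi x) * phi x) =
    \int[mu]_(x in Omega) (h x * psi x).
  apply: eq_Rintegral => x /set_mem Ox.
  by have px := gt_eqF (phi_gt0 Ox); field; rewrite px.
have E' (psi : V) : \int[mu]_(x in Omega) (h x * psi x) =
    \int[mu]_(x in Omega) (h x * phi x * (psi x / phi x)).
  by rewrite -E; apply: eq_Rintegral => x _; ring.
under [X in is_diff_def _ _ X]eq_fun do rewrite E.
have [linL [K LK]] := @Rintegral_linear_bounded _ _ _ mu Omega V
  (fun psi x => psi x / phi x) (fun x => h x * phi x) 1 mOmega Omega_lty
  (bounded_measurableM bh bphi)
  (fun psi => (bounded_measurableM (bV psi) bphiV).1)
  ratio_le (fun k psi1 psi2 x _ => ratioD k psi1 psi2 x).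
rewrite (_ : (fun eta : V => _) = (fun psi : V =>
    \int[mu]_(x in Omega) (h x * phi x * (psi x / phi x)) : R^o)).
  exact: is_diff_linear linL LK.
by apply/funext => psi; exact: E'.
Qed.

(** Product, power and inverse rules applied to G = I2 - I0^-1 * I1^2, where Ik integrates f^k eta;
    the normalization I0(phi) = 1 removes the denominators. *)
Lemma is_diff_sobolG : is_diff phiV (fun eta : V => sobolG a b f eta : R^o)
  (fun psi : V => sobolDG a b f phi psi : R^o).
Proof.
have d2 := is_diff_Rintegral (bounded_measurableX 2 bf).
have d1 := is_diff_Rintegral bf.
have d0 := is_diff_Rintegral (bounded_measurable_cst _ 1).
pose I0 := fun eta : V => \int[mu]_(x in Omega) (1 * eta x) : R^o.
have I01 : I0 phiV = 1.
  rewrite -phi_pdf; apply: eq_Rintegral => x /set_mem Ox.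
  by rewrite mul1r phiVE.
have I1 : \int[mu]_(x in Omega) (f x * phiV x) =
    \int[mu]_(x in Omega) (f x * phi x).
  by apply: eq_Rintegral => x /set_mem Ox; rewrite phiVE.
have I0n : I0 phiV != 0 by rewrite I01 oner_neq0.
have dV : is_diff phiV (fun eta => (I0 eta)^-1 : R^o)
    (- (I0 phiV) ^- 2 \*: 'd I0 phiV : V -> R^o).
  apply: DiffDef; first exact: differentiableV.
  by rewrite diffV.
(* [A], [C], [D] stand for the differentials of the integrals of f^2 eta, f eta and eta, and [B] for
   the integral of f phi. *)
have alg (A B C D : R) :
  A - (1^-1 * (2 * B ^+ 1 * C) + B ^+ 2 * (- 1 ^- 2 * D)) =
  A - 2 * B * C + D * B ^+ 2 by rewrite expr1n invr1; ring.
have := is_diffB d2 (is_diffM dV (is_diffX 1 d1)).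
rewrite (_ : _ - _ = fun eta : V => sobolG a b f eta : R^o).
  move=> dG; apply: (is_diff_eq dG); apply/funext => psi.
  rewrite /sobolDG !fctE /= diff_val I01 I1.
  rewrite (_ : \int[mu]_(x in Omega) (1 * (psi x / phi x) * phi x) =
      \int[mu]_(x in Omega) ((psi x / phi x) * phi x)).
    exact: alg.
  by apply: eq_Rintegral => x _; rewrite mul1r.
apply/funext => eta; rewrite /sobolG !fctE /= /I0 mul1r.
rewrite (_ : \int[mu]_(x in Omega) (1 * eta x) =
    \int[mu]_(x in Omega) (eta x)) //.
by apply: eq_Rintegral => x _; rewrite mul1r.
Qed.

(** * The differential of F *)

Section sobolF.
Context (u : {set 'I_p}).
Local Notation Omega_u := (box (subcoord u a) (subcoord u b)).
Local Notation mu_u := (lebesgue_rV #|u|).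
Local Notation D := (Omega `*` Omega_u).
Local Notation nu := (mu \x mu_u)%E.
Local Notation marginal := (marginal a b u).

Let mD : measurable D.
Proof. by apply: measurableX => //; exact: measurable_box. Qed.

Let D_lty : (nu D < +oo)%E. Proof. exact: dint_box_lty. Qed.

Let bounded_measurable_fst (g : 'rV[R]_p -> R) : bounded_measurable Omega g ->
  bounded_measurable D (fun z => g z.1).
Proof.
move=> bg; have Dfst (z : 'rV[R]_p * 'rV[R]_#|u|) : D z -> Omega z.1 by case.
exact: (bounded_measurable_comp mOmega Dfst measurable_fst bg).
Qed.

Let bounded_measurable_snd (g : 'rV[R]_p -> R) : bounded_measurable Omega g ->
  bounded_measurable D (fun z => g (Defs.glue z.1 z.2)).
Proof.
move=> bg.
have Dglue (z : 'rV[R]_p * 'rV[R]_#|u|) : D z -> Omega (Defs.glue z.1 z.2).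
  by case; exact: glue_box.
exact: (bounded_measurable_comp mOmega Dglue (@measurable_glue R p u) bg).
Qed.

(** The bound is a positive lower bound of [phi] times the volume of [Omega_u]. *)
Let marginal_phi_ge : exists2 c : R, 0 < c &
  forall x, Omega x -> c <= marginal phi x.
Proof.
have [c c0 cphi] := phi_ge phi_cont phi_gt0.
exists (c * fine (mu_u Omega_u)).
  by rewrite mulr_gt0// (subbox_gt0 u ab)// box_measure_neq0.
move=> x Ox; rewrite -(marginal_cst _ _ _ _ x) (le_trans (ler_norm _))//.
apply: (le_marginal u ab) => //; first by apply: bounded_measurable_cst.
by move=> y Oy; rewrite gtr0_norm// cphi.
Qed.

Let marginal_phi_gt0 x : Omega x -> 0 < marginal phi x.
Proof.
by have [c c0 cm] := marginal_phi_ge; move=> /cm; exact: lt_le_trans.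
Qed.

Let bmarginalV : bounded_measurable Omega (fun x => (marginal phi x)^-1).
Proof.
have [c c0 cm] := marginal_phi_ge.
by apply: bounded_measurableV c0 cm _ => //; apply: bounded_measurable_marginal.
Qed.

Let marginal_le (psi : V) x : Omega x ->
  `|marginal psi x| <= `|psi| * marginal phi x.
Proof.
(* A zero function is added so that [marginalD], stated for k g + h, yields homogeneity. *)
move=> Ox; have b0 := bounded_measurable_cst Omega (0 : R).
rewrite -[leRHS]addr0 -[X in _ + X](mul0r (fine (mu_u Omega_u))).
rewrite -(marginal_cst a b u 0 x) -(marginalD u ab)//.
apply: (le_marginal u ab) => //.
  apply: bounded_measurableD => //; apply: bounded_measurableM => //.
  exact: bounded_measurable_cst.
by move=> y Oy; rewrite addr0 wspace_le.
Qed.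

Let al (psi : V) (z : 'rV[R]_p * 'rV[R]_#|u|) : R := psi z.1 / phi z.1.
Let be (psi : V) (z : 'rV[R]_p * 'rV[R]_#|u|) : R :=
  psi (Defs.glue z.1 z.2) / phi (Defs.glue z.1 z.2).
Let ga (psi : V) (z : 'rV[R]_p * 'rV[R]_#|u|) : R :=
  marginal psi z.1 / marginal phi z.1.
Let w (z : 'rV[R]_p * 'rV[R]_#|u|) : R :=
  (f z.1 - f (Defs.glue z.1 z.2)) ^+ 2 * phi z.1 * phi (Defs.glue z.1 z.2) *
  (marginal phi z.1)^-1.

Let bw : bounded_measurable D w.
Proof.
have b1 := bounded_measurable_fst; have b2 := bounded_measurable_snd.
exact: bounded_measurableM (bounded_measurableM (bounded_measurableM
  (bounded_measurableX 2 (bounded_measurableB (b1 _ bf) (b2 _ bf)))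
  (b1 _ bphi)) (b2 _ bphi)) (b1 _ bmarginalV).
Qed.

Let bal psi : bounded_measurable D (al psi).
Proof.
apply: (@bounded_measurable_fst (fun x => psi x / phi x)).
exact: bounded_measurableM.
Qed.

Let bbe psi : bounded_measurable D (be psi).
Proof.
apply: (@bounded_measurable_snd (fun x => psi x / phi x)).
exact: bounded_measurableM.
Qed.

Let bga psi : bounded_measurable D (ga psi).
Proof.
apply: (@bounded_measurable_fst (fun x => marginal psi x / marginal phi x)).
by apply: bounded_measurableM => //; apply: bounded_measurable_marginal.
Qed.

Let al_le psi z : D z -> `|al psi z| <= `|psi|.
Proof. by move=> [Oz _]; rewrite -[leRHS]mul1r ratio_le. Qed.

Let be_le psi z : D z -> `|be psi z| <= `|psi|.
Proof.
by move=> [Oz Oz']; rewrite -[leRHS]mul1r ratio_le//; exact: glue_box.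
Qed.

Let ga_le psi z : D z -> `|ga psi z| <= `|psi|.
Proof.
move=> [Oz _]; have m0 := marginal_phi_gt0 Oz.
by rewrite normrM normfV (gtr0_norm m0) ler_pdivrMr// marginal_le.
Qed.

Let gaD k psi1 psi2 z : D z ->
  ga (k *: psi1 + psi2) z = k * ga psi1 z + ga psi2 z.
Proof.
move=> [Oz _]; rewrite /ga mulrA -mulrDl; congr (_ / _).
exact: (marginalD u ab k (bV psi1) (bV psi2)).
Qed.

Let integrableD g : bounded_measurable D g -> nu.-integrable D (EFin \o g).
Proof. exact: bounded_measurable_integrable. Qed.

Implicit Types (psi : V) (z : 'rV[R]_p * 'rV[R]_#|u|).

(** Unfolding the conditional density shows that the three integrals carry the same weight [w],
    against [be], [al] and [ga] in this order. *)
Let sobolDFE psi : sobolDF a b f u phi psi =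
  2^-1 * \int[nu]_(z in D) (w z * (al psi z + be psi z - ga psi z)).
Proof.
have i1 := integrableD (bounded_measurableM bw (bbe psi)).
have i2 := integrableD (bounded_measurableM bw (bal psi)).
have i3 := integrableD (bounded_measurableM bw (bga psi)).
have i12 := integrableD (bounded_measurableD (bounded_measurableM bw (bbe psi))
  (bounded_measurableM bw (bal psi))).
rewrite /sobolDF -mulrDr -mulrBr; congr (_ * _).
transitivity (\int[nu]_(z in D) (w z * be psi z) +
    \int[nu]_(z in D) (w z * al psi z) - \int[nu]_(z in D) (w z * ga psi z)).
  congr (_ + _ - _); apply: eq_Rintegral => z _;
    rewrite /w /cond_density /al /be /ga /=; ring.
rewrite -RintegralD// -RintegralB//; apply: eq_Rintegral => z _; ring.
Qed.

Let linear_sobolDF : linear (fun psi : V => sobolDF a b f u phi psi : R^o) /\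
  exists K, forall psi : V, `|sobolDF a b f u phi psi| <= K * `|psi|.
Proof.
(* The constant 3 counts [al], [be] and [ga], each bounded by |psi|. *)
have [||linL [K LK]] := @Rintegral_linear_bounded _ _ _ nu D V
  (fun psi z => al psi z + be psi z - ga psi z) w 3 mD D_lty bw
  (fun psi => (bounded_measurableB
    (bounded_measurableD (bal psi) (bbe psi)) (bga psi)).1).
- move=> psi z Dz; rewrite (le_trans (ler_normB _ _))//.
  have := ler_normD (al psi z) (be psi z).
  have := al_le psi Dz; have := be_le psi Dz; have := ga_le psi Dz.
  lra.
- move=> k psi1 psi2 z Dz; rewrite gaD// /al /be !ratioD; ring.
split=> [k psi1 psi2|].
  by rewrite !sobolDFE linL -[_ *: _ in RHS]/(k * _) -[_ *: _]/(k * _); ring.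
exists (2^-1 * K) => psi; rewrite sobolDFE normrM gtr0_norm//.
by rewrite -mulrA ler_pM2l.
Qed.

(** Radius 1/2 keeps the denominator 1 + ga away from 0, uniformly in the point. *)
Let ga_gt0 psi z : D z -> `|psi| <= 2^-1 -> 2^-1 <= 1 + ga psi z.
Proof.
by move=> Dz psi2; have := ga_le psi Dz; rewrite ler_norml => /andP[+ _]; lra.
Qed.

(** Writing psi(x) = al phi(x), and likewise at x' and for the marginals, factors [w] out of the
    integrand. *)
Let sobolFE psi : `|psi| <= 2^-1 -> sobolF a b f u (psi + phiV) =
  2^-1 * \int[nu]_(z in D)
    (w z * ((1 + al psi z) * (1 + be psi z) / (1 + ga psi z))).
Proof.
move=> psi2; congr (_ * _); apply: eq_Rintegral => z /set_mem Dz.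
have [Oz Oz'] : Omega z.1 /\ Omega (Defs.glue z.1 z.2).
  by case: Dz => Oz Oz'; split => //; exact: glue_box.
have mE : marginal (psi + phiV) z.1 = marginal psi z.1 + marginal phi z.1.
  rewrite -[psi in LHS]scale1r.
  apply: etrans (marginalD u ab 1 (bV psi) (bV phiV) Oz) _; rewrite mul1r.
  by congr (_ + _); exact: eq_marginal phiVE Oz.
have VE x : Omega x -> (psi + phiV) x = psi x + phi x.
  by move=> Ox; rewrite -(phiVE Ox).
rewrite mE !VE// /w /al /be.
have := ga_gt0 Dz psi2; rewrite /ga.
have := marginal_phi_gt0 Oz; have := phi_gt0 Oz; have := phi_gt0 Oz'.
move: (marginal psi z.1) (marginal phi z.1) (psi z.1) (psi _) (phi z.1) (phi _)
  (f z.1) (f _).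
move=> n m s s' p0 p0' q q' p0'_gt0 p0_gt0 m_gt0 nm.
(* Multiplying 1/2 <= 1 + n / m by m > 0: the marginal of psi + phi stays positive. *)
have nm0 : n + m != 0.
  have : 0 < 1 + n / m by apply: lt_le_trans nm.
  rewrite -(pmulr_lgt0 _ m_gt0) mulrDl mul1r (divfK (lt0r_neq0 m_gt0)).
  by move=> nm_gt0; rewrite gt_eqF// addrC.
by field; rewrite [m + n]addrC nm0 !lt0r_neq0.
Qed.

Lemma is_diff_sobolF : is_diff phiV (fun eta : V => sobolF a b f u eta : R^o)
  (fun psi : V => sobolDF a b f u phi psi : R^o).
Proof.
have [linL [K LK]] := linear_sobolDF; have [mw [M wM]] := bw.
(* [M] bounds [w], and 8 = 2 * 2 * 2: |al - ga| and |be - ga| are at most 2 |psi|, and 1 / (1 + ga)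
   is at most 2. The leading 1/2 is the prefactor of F. *)
pose K' := 2^-1 * (M * 8 * fine (nu D)).
(* One constant has to serve both the linear bound and the remainder, hence the sum. *)
apply: (@is_diff_quadratic _ _ _ _ _ (`|K| + `|K'|) 2^-1) => // [psi|psi psi2].
  by rewrite (le_trans (LK psi))// ler_wpM2r// (le_trans (ler_norm K))// lerDl.
have F0 : sobolF a b f u phiV = 2^-1 * \int[nu]_(z in D) w z.
  have := @sobolFE 0; rewrite normr0 add0r => -> //; congr (_ * _).
  apply: eq_Rintegral => z /set_mem Dz.
  have ga0 : ga 0 z = 0 by apply/eqP; rewrite -normr_le0 -(normr0 V) ga_le.
  have al0 : al 0 z = 0 by apply/eqP; rewrite -normr_le0 -(normr0 V) al_le.
  have be0 : be 0 z = 0 by apply/eqP; rewrite -normr_le0 -(normr0 V) be_le.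
  by rewrite al0 be0 ga0 addr0 divr1 !mulr1.
have b1 := bounded_measurable_cst D (1 : R).
have b1ga : bounded_measurable D (fun z => (1 + ga psi z)^-1).
  apply: (@bounded_measurableV _ _ _ _ _ 2^-1) => // [z Dz|].
    exact: ga_gt0.
  exact: bounded_measurableD.
have bq := bounded_measurableM bw (bounded_measurableM (bounded_measurableM
  (bounded_measurableD b1 (bal psi)) (bounded_measurableD b1 (bbe psi))) b1ga).
have bl := bounded_measurableM bw
  (bounded_measurableB (bounded_measurableD (bal psi) (bbe psi)) (bga psi)).
rewrite sobolFE// F0 sobolDFE -!mulrBr.
rewrite -RintegralB//; [|exact: integrableD|exact: integrableD].
rewrite -RintegralB//; last 2 first.
- by apply: integrableD; exact: bounded_measurableB.
- exact: integrableD.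
rewrite normrM gtr0_norm// (@le_trans _ _ (K' * `|psi| ^+ 2))//; last first.
  by rewrite ler_wpM2r ?exprn_ge0// (le_trans (ler_norm K'))// lerDr.
rewrite /K' -!mulrA ler_pM2l// [fine _ * _]mulrC !mulrA.
apply: bounded_measurable_normr_Rintegral => //.
  exact: bounded_measurableB (bounded_measurableB bq bw) bl.
move=> z Dz; have g2 := ga_gt0 Dz psi2.
have g0 : 0 < 1 + ga psi z by rewrite (lt_le_trans _ g2).
rewrite (_ : _ - _ - _ =
    w z * ((al psi z - ga psi z) * (be psi z - ga psi z) * (1 + ga psi z)^-1)).
  rewrite normrM -!mulrA ler_pM// ?wM// normrM mulrA.
  rewrite (_ : 8 * _ * _ = (2 * `|psi|) * (2 * `|psi|) * 2); last by ring.
  rewrite [X in _ * X]normrM mulrA; apply: ler_pM => //.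
  - apply: ler_pM => //.
    + rewrite (le_trans (ler_normB _ _))//.
      by have := al_le psi Dz; have := ga_le psi Dz; lra.
    + rewrite (le_trans (ler_normB _ _))//.
      by have := be_le psi Dz; have := ga_le psi Dz; lra.
  - by rewrite gtr0_norm ?invr_gt0// -[leRHS]invrK lef_pV2 ?posrE.
by field; rewrite gt_eqF.
Qed.

End sobolF.

(** * The degenerate case G(phi) = 0 *)

Let integrableO (h : 'rV[R]_p -> R) : bounded_measurable Omega h ->
  mu.-integrable Omega (EFin \o h).
Proof. exact: bounded_measurable_integrable. Qed.

Let le_normr_Rintegral_dom (g h : 'rV[R]_p -> R) : bounded_measurable Omega g ->
  bounded_measurable Omega h -> (forall x, Omega x -> `|g x| <= h x) ->
  `|\int[mu]_(x in Omega) g x| <= \int[mu]_(x in Omega) h x.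
Proof.
move=> bg bh gh; have ig := integrableO bg.
rewrite (le_trans (le_normr_Rintegral _ _))//; apply: le_Rintegral => //.
  exact: (integrable_norm ig).
exact: integrableO.
Qed.

(** With c the mean of f, G(phi) is the integral of (f - c)^2 phi. If it vanishes, the bound of
    |eta| by a multiple of phi carries this over to (f - c)^2 eta, then to (f - c) eta. So f eta and
    f^2 eta integrate to c J and c^2 J, with J the integral of eta, and G(eta) = c^2 J - (c J)^2 / J
    = 0. Estimates of integrals stand in for almost-everywhere statements. *)
Lemma sobolG_eq0 (eta : V) : sobolG a b f phi = 0 -> sobolG a b f eta = 0.
Proof.
set c := \int[mu]_(x in Omega) (f x * phi x).
rewrite {1}/sobolG phi_pdf divr1 mul1r -/c => /eqP.
rewrite subr_eq0 => /eqP f2c.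
have bc := bounded_measurable_cst Omega c.
have bfc := bounded_measurableB bf bc.
have b2 := bounded_measurableX 2 bf.
have bfc2 := bounded_measurableX 2 bfc.
have fE (h : 'rV[R]_p -> R) : bounded_measurable Omega h ->
    \int[mu]_(x in Omega) ((f x - c) * h x) =
    \int[mu]_(x in Omega) (f x * h x) - c * \int[mu]_(x in Omega) h x.
  move=> bh; rewrite -RintegralZl//; last exact: integrableO.
  rewrite -RintegralB//.
  - by apply: eq_Rintegral => x _; rewrite mulrBl.
  - by apply: integrableO; exact: bounded_measurableM.
  - by apply: integrableO; exact: bounded_measurableM.
have f2E (h : 'rV[R]_p -> R) : bounded_measurable Omega h ->
    \int[mu]_(x in Omega) ((f x - c) ^+ 2 * h x) =
    \int[mu]_(x in Omega) (f x ^+ 2 * h x)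
      - 2 * c * \int[mu]_(x in Omega) (f x * h x)
      + c ^+ 2 * \int[mu]_(x in Omega) h x.
  move=> bh; have bfh := bounded_measurableM bf bh.
  have bf2h := bounded_measurableM b2 bh.
  have bcfh := bounded_measurableM (bounded_measurable_cst Omega (2 * c)) bfh.
  have bch := bounded_measurableM (bounded_measurable_cst Omega (c ^+ 2)) bh.
  rewrite -(RintegralZl _ mOmega (integrableO bfh)).
  rewrite -(RintegralZl _ mOmega (integrableO bh)).
  rewrite -RintegralB//; [|exact: integrableO|exact: integrableO].
  rewrite -RintegralD//; last 2 first.
  - by apply: integrableO; exact: bounded_measurableB.
  - exact: integrableO.
  by apply: eq_Rintegral => x _; ring.
have fc2phi : \int[mu]_(x in Omega) ((f x - c) ^+ 2 * phi x) = 0.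
  by rewrite f2E// f2c phi_pdf -/c; ring.
have fc2eta : \int[mu]_(x in Omega) ((f x - c) ^+ 2 * eta x) = 0.
  apply/eqP; rewrite -normr_le0.
  rewrite -[leRHS](mulr0 `|eta|) -fc2phi -RintegralZl//; last first.
    by apply: integrableO; exact: bounded_measurableM.
  apply: le_normr_Rintegral_dom; first exact: bounded_measurableM.
    apply: bounded_measurableM (bounded_measurable_cst _ _) _.
    exact: bounded_measurableM.
  move=> x Ox; rewrite normrM ger0_norm ?sqr_ge0// mulrCA.
  by rewrite ler_wpM2l ?sqr_ge0 ?wspace_le.
have fceta : \int[mu]_(x in Omega) ((f x - c) * eta x) = 0.
  apply/eqP; rewrite -normr_le0; apply/ler_addgt0Pr => e e0; rewrite add0r.
  have eta1 : 0 < `|eta| + 1 by rewrite ltr_wpDl.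
  (* With this [t] the first summand of the dominating function integrates to |eta| t <= e, and the
     second to 0. *)
  pose t := e / (`|eta| + 1); have t0 : 0 < t by rewrite divr_gt0.
  have b1 := bounded_measurableM (bounded_measurable_cst Omega (`|eta| * t))
    bphi.
  have b3 := bounded_measurableM (bounded_measurable_cst Omega (`|eta| / t))
    (bounded_measurableM bfc2 bphi).
  apply: (@le_trans _ _ (\int[mu]_(x in Omega)
      (`|eta| * t * phi x + `|eta| / t * ((f x - c) ^+ 2 * phi x)))).
    apply: le_normr_Rintegral_dom; first exact: bounded_measurableM.
      exact: bounded_measurableD.
    move=> x Ox; rewrite normrM.
    (* AM-GM, letting t tend to 0 *)
    have fct : `|f x - c| <= t + (f x - c) ^+ 2 / t.
      rewrite -(ler_pM2r t0) mulrDl divfK ?gt_eqF// -real_normK ?num_real//.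
      have := mulr_ge0 (normr_ge0 (f x - c)) (ltW t0).
      have := sqr_ge0 (t - `|f x - c|); lra.
    apply: (@le_trans _ _ ((t + (f x - c) ^+ 2 / t) * (`|eta| * phi x))).
      by apply: ler_pM => //; exact: wspace_le.
    by rewrite le_eqVlt; apply/orP; left; apply/eqP; field; rewrite gt_eqF.
  rewrite (RintegralD mOmega (integrableO b1) (integrableO b3)).
  rewrite (RintegralZl _ mOmega (integrableO bphi)).
  rewrite (RintegralZl _ mOmega (integrableO (bounded_measurableM bfc2 bphi))).
  rewrite fc2phi mulr0 addr0 phi_pdf mulr1 /t mulrA ler_pdivrMr// mulrC.
  by rewrite ler_pM2l// lerDl.
have f1 := fE _ (bV eta); have f2 := f2E _ (bV eta).
move: f1 f2; rewrite fceta fc2eta /sobolG.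
move: (Rintegral _ _ (fun x => f x * eta x)) => I1.
move: (Rintegral _ _ (fun x => f x ^+ 2 * eta x)) => I2.
move: (Rintegral _ _ _) => J /esym/eqP; rewrite subr_eq0 => /eqP ->.
(* For J = 0 the inverse of J is 0 by convention, and the expansion of (f - c)^2 leaves I2 = 0. *)
have [->|J0] := eqVneq J 0 => f2.
  by rewrite invr0 !mulr0 !mul0r subr0; move: f2; rewrite !mulr0 subr0 addr0.
have -> : I2 = c ^+ 2 * J by lra.
by field.
Qed.

(** * The quotient rule for T *)

Lemma is_diff_sobolT (u : {set 'I_p}) :
  is_diff phiV (fun eta : V => sobolT a b f u eta : R^o)
    (fun psi : V => sobolDT a b f u phi psi : R^o).
Proof.
(* The formulas are stated at [phi], while the point of differentiation is [phiV]; integrals over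
   the boxes do not see the difference. *)
have GE : sobolG a b f phiV = sobolG a b f phi.
  by rewrite /sobolG; congr (_ - 1 / _ * _ ^+ 2);
    apply: eq_Rintegral => x /set_mem Ox; rewrite phiVE.
have FE : sobolF a b f u phiV = sobolF a b f u phi.
  congr (_ * _); apply: eq_Rintegral => z /set_mem[Oz Oz'].
  by rewrite !phiVE ?(eq_marginal u phiVE)//; exact: glue_box.
(* If G(phi) = 0, not only T but also the candidate differential is identically 0, by the convention
   on division. *)
have [G0|G0] := eqVneq (sobolG a b f phi) 0.
  rewrite (_ : (fun eta : V => _) = cst 0); last first.
    by apply/funext => eta; rewrite /sobolT sobolG_eq0// invr0 mulr0.
  rewrite (_ : (fun psi : V => _) = 0); first exact: is_diff_cst.
  by apply/funext => psi; rewrite /sobolDT /sobolT G0 invr0 !mulr0 subr0.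
have dF := is_diff_sobolF u; have dG := is_diff_sobolG.
pose G := fun eta : V => sobolG a b f eta : R^o.
have dV : is_diff phiV (fun eta => (G eta)^-1 : R^o)
    (- (G phiV) ^- 2 \*: 'd G phiV : V -> R^o).
  apply: DiffDef; first by apply: differentiableV => //; rewrite /G GE.
  by rewrite diffV// /G GE.
have dT := is_diffM dF dV; apply: (is_diff_eq dT); apply/funext => psi.
rewrite !fctE /= diff_val /sobolDT /sobolT.
have alg (x y dx dy : R) : y != 0 -> x * (- y ^- 2 * dy) + y^-1 * dx =
  dx / y - x / y * (dy / y) by move=> y0; field.
by rewrite /G FE GE; exact: alg.
Qed.

End sobol_differential.

Unset Implicit Arguments.
Set Strict Implicit.
Set Printing Implicit Defensive.

(** [is_diff] comprises continuity of the differential, so the formulas define bounded linear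
    operators; [R^o] is R as a normed space over itself. *)
Theorem theorem3p1 (R : realType) (p : nat) (a b : 'rV[R]_p)
  (ab : forall i, a ord0 i <= b ord0 i)
  (phi : 'rV[R]_p -> R)
  (phi_cont : {within box a b, continuous phi})
  (phi_gt0 : forall x, box a b x -> 0 < phi x)
  (phi_pdf : \int[lebesgue_rV p]_(x in box a b) phi x = 1)
  (f : 'rV[R]_p -> R)
  (f_meas : measurable_fun (box a b) f)
  (f_bnd : [bounded f x | x in box a b])
  (u : {set 'I_p}) :
  let V := wspace phi_cont phi_gt0 in
  let phiV : V := weight phi_cont phi_gt0 in
  [/\ is_diff phiV (fun eta : V => sobolT a b f u eta : R^o)
        (fun psi : V => sobolDT a b f u phi psi : R^o),
      is_diff phiV (fun eta : V => sobolF a b f u eta : R^o)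
        (fun psi : V => sobolDF a b f u phi psi : R^o)
    & is_diff phiV (fun eta : V => sobolG a b f eta : R^o)
        (fun psi : V => sobolDG a b f phi psi : R^o)].
Proof.
have bf : bounded_measurable (box a b) f.
  (* Boundedness provides every number larger than [M] as a bound, not [M] itself; hence M + 1. *)
  split => //; have [M [_ fM]] := f_bnd; exists (M + 1) => x Ox.
  by apply: fM => //; rewrite ltrDl.
split; [exact: is_diff_sobolT|exact: is_diff_sobolF|exact: is_diff_sobolG].
Qed.
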